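(* Let $P$ be a preordered set, let $\Lambda$ be a translation of $P$, and let $D$ be a category. Then there is an isomorphism of categories $$D^{\Sigma_\Lambda P} \cong \mathrm{Int}_\Lambda(P,D),$$ where $\Sigma_\Lambda P$ is the $\Lambda$-shoelace proset of $P$, $D^{\Sigma_\Lambda P}$ is the category of $D$-valued representations of $\Sigma_\Lambda P$, and $\mathrm{Int}_\Lambda(P,D)$ is the category of $\Lambda$-interleavings of $D^P$.
   Context: A preordered set (proset) $P$ is a set with a reflexive transitive relation $\leq$; it is viewed as a category with a unique morphism $x\to y$, itself denoted $x\leq y$ or $y\geq x$, exactly when $x\leq y$. For a category $D$, $D^P$ denotes the category of $D$-valued representations of $P$: objects are functors $P\to D$, morphisms are natural transformations. A translation of $P$ is a functor (i.e. monotone map) $\Lambda:P\to P$ such that $x\leq\Lambda(x)$ for all $x\in P$. Its natural transformation $\eta_\Lambda:1_P\to\Lambda$ is given by $\eta_\Lambda(x)=(x\leq\Lambda(x))$. For $M\in D^P$, $M\Lambda:=M\circ\Lambda$, and $M\eta_\Lambda:M\to M\Lambda$ is given by $(M\eta_\Lambda)(x)=M(x\leq\Lambda(x))$. For a morphism $\phi:M\to N$ in $D^P$, $\phi\Lambda:M\Lambda\to N\Lambda$ is given by $(\phi\Lambda)(x)=\phi(\Lambda(x))$. A $\Lambda$-interleaving of $M,N\in D^P$ is a pair of morphisms $\phi:M\to N\Lambda$, $\psi:N\to M\Lambda$ with $(\psi\Lambda)\phi=M\eta_{\Lambda\Lambda}$ and $(\phi\Lambda)\psi=N\eta_{\Lambda\Lambda}$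 (where $\Lambda\Lambda$ is the composite translation). The category $\mathrm{Int}_\Lambda(P,D)$: objects are $4$-tuples $(M,N,\phi,\psi)$ with $M,N\in D^P$ and $(\phi,\psi)$ a $\Lambda$-interleaving of $M,N$. A morphism $(M,N,\phi,\psi)\to(M',N',\phi',\psi')$ is a pair of morphisms $g_M:M\to M'$, $g_N:N\to N'$ in $D^P$ with $\phi' g_M=(g_N\Lambda)\phi$ and $\psi' g_N=(g_M\Lambda)\psi$. Composition is component-wise. The $\Lambda$-shoelace proset $\Sigma_\Lambda P$ has underlying set $P\sqcup P'=\{i\}_{i\in P}\sqcup\{i'\}_{i\in P}$ (two copies of $P$), with, for $i,j\in P$: $i\leq j$ in $\Sigma_\Lambda P$ iff $i'\leq j'$ in $\Sigma_\Lambda P$ iff $i\leq j$ in $P$; and $i\leq j'$ in $\Sigma_\Lambda P$ iff $i'\leq j$ in $\Sigma_\Lambda P$ iff $\Lambda(i)\leq j$ in $P$. *)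

(* Defs.v *)
From Stdlib Require Import RelationClasses FunctionalExtensionality ProofIrrelevance.

Set Implicit Arguments.
Unset Strict Implicit.
Unset Printing Implicit Defensive.

Record Category : Type := {
  ob :> Type;
  hom : ob -> ob -> Type;
  idm : forall x, hom x x;
  comp : forall x y z, hom y z -> hom x y -> hom x z;
  comp_idl : forall x y (f : hom x y), comp (idm y) f = f;
  comp_idr : forall x y (f : hom x y), comp f (idm x) = f;
  comp_assoc : forall w x y z (h : hom y z) (g : hom x y) (f : hom w x),
    comp h (comp g f) = comp (comp h g) f
}.

Arguments hom {c} x y.
Arguments idm {c} x.
Arguments comp {c x y z} g f.

Declare Scope cat_scope.
Delimit Scope cat_scope with cat.
Open Scope cat_scope.
Infix "\o" := comp (at level 40, left associativity) : cat_scope.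

Record Functor (C D : Category) : Type := {
  fob :> C -> D;
  fmap : forall x y : C, hom x y -> hom (fob x) (fob y);
  fmap_id : forall x : C, fmap (idm x) = idm (fob x);
  fmap_comp : forall (x y z : C) (g : hom y z) (f : hom x y),
    fmap (g \o f) = fmap g \o fmap f
}.

Arguments fmap {C D} F {x y} f : rename.

Definition id_functor (C : Category) : Functor C C.
Proof.
refine {| fob := fun x : C => x; fmap := fun x y (f : hom x y) => f |}; reflexivity.
Defined.

Definition comp_functor (A B C : Category) (G : Functor B C) (F : Functor A B) :
  Functor A C.
Proof.
refine {| fob := fun x : A => G (F x);
          fmap := fun x y (f : hom x y) => fmap G (fmap F f) |}.
- intros x; now rewrite !fmap_id.
- intros x y z g f; now rewrite !fmap_comp.
Defined.

Record NatTrans (C D : Category) (F G : Functor C D) : Type := {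
  component :> forall x : C, hom (F x) (G x);
  naturality : forall (x y : C) (f : hom x y),
    component y \o fmap F f = fmap G f \o component x
}.

Lemma NatTrans_ext (C D : Category) (F G : Functor C D) (a b : NatTrans F G) :
  (forall x, a x = b x) -> a = b.
Proof.
destruct a as [a na], b as [b nb]; simpl; intros H.
assert (E : a = b) by now apply functional_extensionality_dep.
subst b; f_equal; apply proof_irrelevance.
Qed.

Definition id_nat (C D : Category) (F : Functor C D) : NatTrans F F.
Proof.
refine {| component := fun x => idm (F x) |}.
intros x y f; now rewrite comp_idl, comp_idr.
Defined.

Definition comp_nat (C D : Category) (F G H : Functor C D)
  (b : NatTrans G H) (a : NatTrans F G) : NatTrans F H.
Proof.
refine {| component := fun x => b x \o a x |}.
intros x y f.
now rewrite <- comp_assoc, naturality, comp_assoc, naturality, comp_assoc.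
Defined.

Definition functor_cat (C D : Category) : Category.
Proof.
refine {| ob := Functor C D; hom := @NatTrans C D;
          idm := @id_nat C D; comp := @comp_nat C D |};
intros; apply NatTrans_ext; intros; simpl.
- apply comp_idl.
- apply comp_idr.
- apply comp_assoc.
Defined.

Definition whisker (B C D : Category) (F G : Functor C D)
  (a : NatTrans F G) (L : Functor B C) :
  NatTrans (comp_functor F L) (comp_functor G L).
Proof.
refine {| component := fun x => a (L x)
            : hom (comp_functor F L x) (comp_functor G L x) |}.
intros x y f; simpl; apply naturality.
Defined.

(* Isomorphism in the strict sense: both round trips are equal (not merely
   naturally isomorphic) to the identity functors. *)
Definition cat_isomorphic (C D : Category) : Prop :=
  exists (F : Functor C D) (G : Functor D C),
    comp_functor G F = id_functor C /\ comp_functor F G = id_functor D.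

Record Proset : Type := {
  pcar :> Type;
  ple : pcar -> pcar -> Prop;
  ple_preorder : PreOrder ple
}.

Arguments ple {p} x y.
#[global] Existing Instance ple_preorder.

Infix "<=p" := ple (at level 70, no associativity) : cat_scope.

(* Hom-sets are the propositions [x <=p y] themselves; proof irrelevance makes
   the category thin. *)
Definition proset_cat (P : Proset) : Category.
Proof.
refine {| ob := P; hom := fun x y : P => x <=p y;
          idm := fun x => PreOrder_Reflexive x;
          comp := fun x y z g f => PreOrder_Transitive x y z f g |};
intros; apply proof_irrelevance.
Defined.

Lemma proset_thin (P : Proset) (x y : proset_cat P) (f g : hom x y) : f = g.
Proof. exact (proof_irrelevance (ple (p := P) x y) f g). Qed.

Definition Rep (P : Proset) (D : Category) : Category :=
  functor_cat (proset_cat P) D.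

Record Translation (P : Proset) : Type := {
  tfun :> Functor (proset_cat P) (proset_cat P);
  tincr : forall x : P, x <=p tfun x
}.

Lemma translation_mono (P : Proset) (L : Translation P) (x y : P) :
  x <=p y -> L x <=p L y.
Proof. exact (@fmap _ _ L x y). Qed.

Definition comp_translation (P : Proset) (L K : Translation P) : Translation P.
Proof.
refine {| tfun := comp_functor L K |}.
intros x; simpl.
transitivity (K x); apply tincr.
Defined.

Definition eta (P : Proset) (L : Translation P) :
  NatTrans (id_functor (proset_cat P)) L.
Proof.
refine {| component := fun x : proset_cat P =>
            (tincr L x : @hom (proset_cat P) (id_functor _ x) (L x)) |}.
intros x y f; apply proset_thin.
Defined.

Definition rep_eta (P : Proset) (D : Category) (M : Rep P D) (L : Translation P) :
  NatTrans M (comp_functor M L).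
Proof.
refine {| component := fun x : proset_cat P =>
            fmap M (eta L x) : hom (M x) (comp_functor M L x) |}.
intros x y f; simpl.
rewrite <- !fmap_comp; f_equal; apply proset_thin.
Defined.

(* The representations [(M L) L] and [M (L L)] have convertible object and
   morphism parts but different proofs of the functor laws, so the two
   interleaving identities, which are equalities of natural transformations,
   are stated on components. *)
Record Interleaving (P : Proset) (D : Category) (L : Translation P)
    (M N : Rep P D) : Type := {
  il_phi : NatTrans M (comp_functor N L);
  il_psi : NatTrans N (comp_functor M L);
  il_psi_phi : forall x : P,
    comp_nat (whisker il_psi L) il_phi x = rep_eta M (comp_translation L L) x;
  il_phi_psi : forall x : P,
    comp_nat (whisker il_phi L) il_psi x = rep_eta N (comp_translation L L) x
}.

Record IntOb (P : Proset) (D : Category) (L : Translation P) : Type := {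
  int_M : Rep P D;
  int_N : Rep P D;
  int_il :> Interleaving L int_M int_N
}.

Record IntHom (P : Proset) (D : Category) (L : Translation P)
    (X Y : IntOb D L) : Type := {
  int_gM : NatTrans (int_M X) (int_M Y);
  int_gN : NatTrans (int_N X) (int_N Y);
  int_sq_phi :
    comp_nat (il_phi Y) int_gM = comp_nat (whisker int_gN L) (il_phi X);
  int_sq_psi :
    comp_nat (il_psi Y) int_gN = comp_nat (whisker int_gM L) (il_psi X)
}.

Lemma IntHom_ext (P : Proset) (D : Category) (L : Translation P)
    (X Y : IntOb D L) (f g : IntHom X Y) :
  int_gM f = int_gM g -> int_gN f = int_gN g -> f = g.
Proof.
destruct f, g; simpl; intros; subst; f_equal; apply proof_irrelevance.
Qed.

Definition int_id (P : Proset) (D : Category) (L : Translation P)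
  (X : IntOb D L) : IntHom X X.
Proof.
refine {| int_gM := id_nat (int_M X); int_gN := id_nat (int_N X) |};
apply NatTrans_ext; intros x; simpl; now rewrite comp_idl, comp_idr.
Defined.

Definition int_comp (P : Proset) (D : Category) (L : Translation P)
  (X Y Z : IntOb D L) (g : IntHom Y Z) (f : IntHom X Y) : IntHom X Z.
Proof.
refine {| int_gM := comp_nat (int_gM g) (int_gM f);
          int_gN := comp_nat (int_gN g) (int_gN f) |};
apply NatTrans_ext; intros x; simpl.
- pose proof (f_equal (fun a => component a x) (int_sq_phi f)) as Ef.
  pose proof (f_equal (fun a => component a x) (int_sq_phi g)) as Eg.
  simpl in Ef, Eg.
  now rewrite comp_assoc, Eg, <- comp_assoc, Ef, comp_assoc.
- pose proof (f_equal (fun a => component a x) (int_sq_psi f)) as Ef.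
  pose proof (f_equal (fun a => component a x) (int_sq_psi g)) as Eg.
  simpl in Ef, Eg.
  now rewrite comp_assoc, Eg, <- comp_assoc, Ef, comp_assoc.
Defined.

Definition Int (P : Proset) (D : Category) (L : Translation P) : Category.
Proof.
refine {| ob := IntOb D L; hom := @IntHom P D L;
          idm := @int_id P D L; comp := @int_comp P D L |};
intros; apply IntHom_ext; apply NatTrans_ext; intros; simpl;
auto using comp_idl, comp_idr, comp_assoc.
Defined.

(* [inl i] is the unprimed copy of [i], [inr i] the primed copy. *)
Definition shoelace_le (P : Proset) (L : Translation P) (x y : P + P) : Prop :=
  match x, y with
  | inl i, inl j | inr i, inr j => i <=p j
  | inl i, inr j | inr i, inl j => L i <=p j
  end.

Lemma shoelace_preorder (P : Proset) (L : Translation P) :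
  PreOrder (shoelace_le L).
Proof.
split.
- intros [i|i]; simpl; reflexivity.
- intros [i|i] [j|j] [k|k]; simpl; intros H1 H2;
  solve [ now transitivity j
        | transitivity (L j); [now apply translation_mono | exact H2]
        | transitivity (L i); [apply tincr |];
          transitivity j; [exact H1 |]; transitivity (L j); [apply tincr | exact H2] ].
Qed.

Definition shoelace (P : Proset) (L : Translation P) : Proset :=
  {| pcar := (P + P)%type; ple := shoelace_le L;
     ple_preorder := shoelace_preorder L |}.

(* Main.v *)
From Stdlib Require Import FunctionalExtensionality ProofIrrelevance.
Require Import Defs.

(** In the shoelace proset every relation that changes copy factors through a
    distinguished one: [i <= j'] holds iff [L i <= j], and then it is the
    composite of [i <= (L i)'] with [(L i)' <= j'].  A representation [V] of the
    shoelace is therefore determined by its restrictions [M], [N] to the two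
    copies of [P] and by the maps [phi i = V (i <= (L i)')] and
    [psi i = V (i' <= L i)].  Functoriality of [V] on squares makes [phi] and
    [psi] natural, and functoriality on [i <= (L i)' <= L (L i)] and on its
    mirror image gives the two interleaving identities.

    Conversely, [M], [N], [phi] and [psi] define [V] on a crossing relation by
    [N (L i <= j) \o phi i] or its mirror image.  Checking that this preserves
    composition ([glue_map_comp]) uses naturality when a step inside one copy
    precedes a single crossing ([step_then_cross]), and naturality together with
    the interleaving identity when the composite crosses twice ([cross_twice]).
    Naturality of a morphism of shoelace representations along the
    distinguished crossings is exactly compatibility with [phi] and [psi], so
    the correspondence extends to morphisms.

    Both round trips are the identity on objects and morphisms on the nose, but
    Rocq sees this only up to propositional equality of objects of functor
    categories.  The comparison is made with the canonical morphism [eq_hom]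
    attached to an equality of objects: [functor_ext] and [IntOb_ext] reduce
    equality of functors and of interleavings to commuting squares with
    [eq_hom] sides, and componentwise these sides are identities because
    proofs of equality are unique. *)

(** * Equality of functors *)

(** Stating compatibility through [eq_hom] rather than by transport keeps
    the squares below within the language of the category, where the component
    of an [eq_hom] can be computed. *)
Definition eq_hom (C : Category) (x y : C) (e : x = y) : hom x y :=
  match e in _ = z return hom x z with eq_refl => idm x end.

Lemma eq_hom_id (C : Category) (x : C) (e : x = x) : eq_hom C x x e = idm x.
Proof. now rewrite (proof_irrelevance _ e eq_refl). Qed.

Lemma functor_ext (C D : Category) (F G : Functor C D)
    (e : forall x, F x = G x) :
  (forall (x y : C) (f : hom x y),
     eq_hom D _ _ (e y) \o fmap F f = fmap G f \o eq_hom D _ _ (e x)) ->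
  F = G.
Proof.
destruct F as [Fo Fm Fi Fc], G as [Go Gm Gi Gc]; simpl in *; intros H.
assert (E : Fo = Go) by now apply functional_extensionality.
subst Go.
assert (Em : Fm = Gm).
{ do 3 (apply functional_extensionality_dep; intro).
  specialize (H x x0 x1).
  now rewrite !eq_hom_id, comp_idl, comp_idr in H. }
subst Gm; f_equal; apply proof_irrelevance.
Qed.

Lemma eq_hom_component (C D : Category) (F G : functor_cat C D) (e : F = G)
    (x : C) (ex : F x = G x) :
  component (eq_hom (functor_cat C D) F G e) x = eq_hom D _ _ ex.
Proof. destruct e; simpl; now rewrite eq_hom_id. Qed.

(** * Representations of prosets *)

Lemma rep_id (P : Proset) (D : Category) (M : Rep P D) (i : proset_cat P)
    (h : hom i i) : fmap M h = idm (M i).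
Proof. rewrite (proset_thin h (idm i)); apply fmap_id. Qed.

(** Since a proset is thin, the composite may be given by any proof of the
    relation, whatever its syntactic origin. *)
Lemma rep_comp (P : Proset) (D : Category) (M : Rep P D) (i j k : proset_cat P)
    (g : hom j k) (f : hom i j) (h : hom i k) : fmap M g \o fmap M f = fmap M h.
Proof. rewrite <- fmap_comp; f_equal; apply proset_thin. Qed.

(** * From shoelace representations to interleavings *)

Definition unprimed (P : Proset) (L : Translation P) :
  Functor (proset_cat P) (proset_cat (shoelace L)).
Proof.
refine {| fob := fun i : proset_cat P => inl i : proset_cat (shoelace L);
          fmap := fun i j (h : hom i j) =>
            h : @hom (proset_cat (shoelace L)) (inl i) (inl j) |};
intros; apply proset_thin.
Defined.

Definition primed (P : Proset) (L : Translation P) :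
  Functor (proset_cat P) (proset_cat (shoelace L)).
Proof.
refine {| fob := fun i : proset_cat P => inr i : proset_cat (shoelace L);
          fmap := fun i j (h : hom i j) =>
            h : @hom (proset_cat (shoelace L)) (inr i) (inr j) |};
intros; apply proset_thin.
Defined.

Definition cross (P : Proset) (L : Translation P) :
  NatTrans (unprimed P L) (comp_functor (primed P L) L).
Proof.
refine {| component := fun i : proset_cat P =>
            (idm (L i) : @hom (proset_cat (shoelace L)) (inl i) (inr (L i)))
            : hom (unprimed P L i) (comp_functor (primed P L) L i) |}.
intros; apply proset_thin.
Defined.

Definition cross_back (P : Proset) (L : Translation P) :
  NatTrans (primed P L) (comp_functor (unprimed P L) L).
Proof.
refine {| component := fun i : proset_cat P =>
            (idm (L i) : @hom (proset_cat (shoelace L)) (inr i) (inl (L i)))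
            : hom (primed P L i) (comp_functor (unprimed P L) L i) |}.
intros; apply proset_thin.
Defined.

Definition split_phi (P : Proset) (L : Translation P) (D : Category)
    (V : Rep (shoelace L) D) :
  NatTrans (comp_functor V (unprimed P L))
           (comp_functor (comp_functor V (primed P L)) L).
Proof.
refine {| component := fun i : proset_cat P => fmap V (cross P L i)
            : hom (comp_functor V (unprimed P L) i)
                  (comp_functor (comp_functor V (primed P L)) L i) |}.
intros i j h; simpl; rewrite <- !fmap_comp; f_equal; apply proset_thin.
Defined.

Definition split_psi (P : Proset) (L : Translation P) (D : Category)
    (V : Rep (shoelace L) D) :
  NatTrans (comp_functor V (primed P L))
           (comp_functor (comp_functor V (unprimed P L)) L).
Proof.
refine {| component := fun i : proset_cat P => fmap V (cross_back P L i)
            : hom (comp_functor V (primed P L) i)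
                  (comp_functor (comp_functor V (unprimed P L)) L i) |}.
intros i j h; simpl; rewrite <- !fmap_comp; f_equal; apply proset_thin.
Defined.

Definition split_ob (P : Proset) (L : Translation P) (D : Category)
    (V : Rep (shoelace L) D) : IntOb D L.
Proof.
refine {| int_M := comp_functor V (unprimed P L) : Rep P D;
          int_N := comp_functor V (primed P L) : Rep P D;
          int_il := {| il_phi := split_phi P L D V;
                       il_psi := split_psi P L D V |} |};
intros i; simpl; apply (rep_comp (shoelace L) D V).
Defined.

Definition split_hom (P : Proset) (L : Translation P) (D : Category)
    (V W : Rep (shoelace L) D) (a : NatTrans V W) :
  IntHom (split_ob P L D V) (split_ob P L D W).
Proof.
refine {| int_gM := whisker a (unprimed P L)
            : NatTrans (int_M (split_ob P L D V)) (int_M (split_ob P L D W));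
          int_gN := whisker a (primed P L)
            : NatTrans (int_N (split_ob P L D V)) (int_N (split_ob P L D W)) |};
apply NatTrans_ext; intros i; simpl; symmetry; apply naturality.
Defined.

Definition split_functor (P : Proset) (L : Translation P) (D : Category) :
  Functor (Rep (shoelace L) D) (Int D L).
Proof.
refine {| fob := split_ob P L D : Rep (shoelace L) D -> Int D L;
          fmap := split_hom P L D |};
intros; apply IntHom_ext; now apply NatTrans_ext.
Defined.

(** * From interleavings to shoelace representations *)

Definition glue_ob (P : Proset) (L : Translation P) (D : Category)
    (X : IntOb D L) (s : P + P) : D :=
  match s with
  | inl i => int_M X i
  | inr i => int_N X i
  end.

Definition glue_map (P : Proset) (L : Translation P) (D : Category)
    (X : IntOb D L) (s t : P + P) :
  shoelace_le L s t -> hom (glue_ob P L D X s) (glue_ob P L D X t) :=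
  match s, t return
    shoelace_le L s t -> hom (glue_ob P L D X s) (glue_ob P L D X t) with
  | inl i, inl j => fun h => @fmap (proset_cat P) D (int_M X) i j h
  | inr i, inr j => fun h => @fmap (proset_cat P) D (int_N X) i j h
  | inl i, inr j => fun h =>
      @fmap (proset_cat P) D (int_N X) (L i) j h \o il_phi X i
  | inr i, inl j => fun h =>
      @fmap (proset_cat P) D (int_M X) (L i) j h \o il_psi X i
  end.

(** Naturality of [psi] moves [f] past the second crossing, so that the two
    crossings meet and the interleaving identity turns them into a structure
    map of [M]. *)
Lemma cross_twice (P : Proset) (L : Translation P) (D : Category)
    (M N : Rep P D) (phi : NatTrans M (comp_functor N L))
    (psi : NatTrans N (comp_functor M L)) (i j k : proset_cat P)
    (psi_phi : psi (L i) \o phi i = rep_eta M (comp_translation L L) i)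
    (g : hom (L j) k) (f : hom (L i) j) (h : hom i k) :
  (fmap M g \o psi j) \o (fmap N f \o phi i) = fmap M h.
Proof.
pose proof (naturality psi f) as E; simpl in *.
rewrite comp_assoc, <- (comp_assoc (fmap M g)), E.
rewrite <- !comp_assoc, psi_phi, <- !fmap_comp; f_equal; apply proset_thin.
Qed.

(** Crossing after a step inside the first copy: naturality moves the step past
    the crossing. *)
Lemma step_then_cross (P : Proset) (L : Translation P) (D : Category)
    (M N : Rep P D) (phi : NatTrans M (comp_functor N L)) (i j k : proset_cat P)
    (g : hom (L j) k) (f : hom i j) (h : hom (L i) k) :
  (fmap N g \o phi j) \o fmap M f = fmap N h \o phi i.
Proof.
pose proof (naturality phi f) as E; simpl in *.
now rewrite <- comp_assoc, E, comp_assoc, (rep_comp P D N _ _ _ _ _ h).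
Qed.

Lemma glue_map_comp (P : Proset) (L : Translation P) (D : Category)
    (X : IntOb D L) (s t u : P + P) (g : shoelace_le L t u)
    (f : shoelace_le L s t) (h : shoelace_le L s u) :
  glue_map P L D X s u h = glue_map P L D X t u g \o glue_map P L D X s t f.
Proof.
symmetry; destruct s as [i|i], t as [j|j], u as [k|k]; simpl in *;
first [ apply rep_comp
      | apply step_then_cross
      | rewrite comp_assoc; f_equal; apply rep_comp
      | apply cross_twice ].
- exact (il_psi_phi X i).
- exact (il_phi_psi X i).
Qed.

Definition glue_rep (P : Proset) (L : Translation P) (D : Category)
    (X : IntOb D L) : Rep (shoelace L) D.
Proof.
refine {| fob := glue_ob P L D X : proset_cat (shoelace L) -> D;
          fmap := glue_map P L D X |}.
- intros [i|i]; apply (rep_id P D).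
- intros; apply glue_map_comp.
Defined.

Definition glue_component (P : Proset) (L : Translation P) (D : Category)
    (X Y : IntOb D L) (a : IntHom X Y) (s : P + P) :
  hom (glue_ob P L D X s) (glue_ob P L D Y s) :=
  match s with
  | inl i => int_gM a i
  | inr i => int_gN a i
  end.

Definition glue_nat (P : Proset) (L : Translation P) (D : Category)
    (X Y : IntOb D L) (a : IntHom X Y) :
  NatTrans (glue_rep P L D X) (glue_rep P L D Y).
Proof.
refine {| component := glue_component P L D X Y a
            : forall s : proset_cat (shoelace L),
                hom (glue_rep P L D X s) (glue_rep P L D Y s) |}.
intros [i|i] [j|j] h; simpl in *; try apply naturality.
- pose proof (f_equal (fun b => component b (i : proset_cat P)) (int_sq_phi a))
    as E; simpl in E.
  pose proof (naturality (int_gN a) (h : @hom (proset_cat P) (L i) j)) as E'.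
  now rewrite comp_assoc, E', <- !comp_assoc, E.
- pose proof (f_equal (fun b => component b (i : proset_cat P)) (int_sq_psi a))
    as E; simpl in E.
  pose proof (naturality (int_gM a) (h : @hom (proset_cat P) (L i) j)) as E'.
  now rewrite comp_assoc, E', <- !comp_assoc, E.
Defined.

Definition glue_functor (P : Proset) (L : Translation P) (D : Category) :
  Functor (Int D L) (Rep (shoelace L) D).
Proof.
refine {| fob := glue_rep P L D : Int D L -> Rep (shoelace L) D;
          fmap := glue_nat P L D |};
intros; apply NatTrans_ext; now intros [i|i].
Defined.

(** * The round trips *)

Lemma glue_split_value (P : Proset) (L : Translation P) (D : Category)
    (V : Rep (shoelace L) D) (s : proset_cat (shoelace L)) :
  glue_rep P L D (split_ob P L D V) s = V s.
Proof. now destruct s. Qed.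

(** On a crossing relation the two functors agree because [i <= j'] factors
    through [(L i)']. *)
Lemma glue_split_ob (P : Proset) (L : Translation P) (D : Category)
    (V : Rep (shoelace L) D) : glue_rep P L D (split_ob P L D V) = V.
Proof.
apply (functor_ext _ _ _ _ (glue_split_value P L D V)).
intros [i|i] [j|j] h; rewrite !eq_hom_id, comp_idl, comp_idr; simpl;
first [ reflexivity | apply (rep_comp (shoelace L) D V) ].
Qed.

Lemma glue_split (P : Proset) (L : Translation P) (D : Category) :
  comp_functor (glue_functor P L D) (split_functor P L D) =
  id_functor (Rep (shoelace L) D).
Proof.
apply (functor_ext _ _ (comp_functor (glue_functor P L D) (split_functor P L D))
  (id_functor (Rep (shoelace L) D)) (glue_split_ob P L D)).
intros V W a; apply NatTrans_ext; intros s; simpl.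
rewrite !(eq_hom_component _ _ _ _ _ s (glue_split_value P L D _ s)).
destruct s as [i|i]; rewrite !eq_hom_id; simpl; now rewrite comp_idl, comp_idr.
Qed.

(** The equalities of values [oM] and [oN] are independent of [eM] and [eN], so
    that they can be taken to be [eq_refl] whenever the values are convertible,
    although the functors are only provably equal. *)
Lemma IntOb_ext (P : Proset) (L : Translation P) (D : Category)
    (X Y : IntOb D L)
    (eM : int_M X = int_M Y) (eN : int_N X = int_N Y)
    (oM : forall i, int_M X i = int_M Y i)
    (oN : forall i, int_N X i = int_N Y i) :
  (forall i : proset_cat P,
     eq_hom D _ _ (oN (L i)) \o il_phi X i = il_phi Y i \o eq_hom D _ _ (oM i)) ->
  (forall i : proset_cat P,
     eq_hom D _ _ (oM (L i)) \o il_psi X i = il_psi Y i \o eq_hom D _ _ (oN i)) ->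
  X = Y.
Proof.
destruct X as [M N [phi psi p1 p2]], Y as [M' N' [phi' psi' q1 q2]].
simpl in *; subst M' N'; intros Hphi Hpsi.
assert (phi = phi').
{ apply NatTrans_ext; intros i; specialize (Hphi i).
  now rewrite !eq_hom_id, comp_idl, comp_idr in Hphi. }
assert (psi = psi').
{ apply NatTrans_ext; intros i; specialize (Hpsi i).
  now rewrite !eq_hom_id, comp_idl, comp_idr in Hpsi. }
subst phi' psi'; do 2 f_equal; apply proof_irrelevance.
Qed.

Lemma split_glue_M (P : Proset) (L : Translation P) (D : Category)
    (X : IntOb D L) : int_M (split_ob P L D (glue_rep P L D X)) = int_M X.
Proof.
apply (functor_ext (proset_cat P) D
  (int_M (split_ob P L D (glue_rep P L D X))) (int_M X) (fun i => eq_refl)).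
intros i j h; simpl; now rewrite comp_idl, comp_idr.
Qed.

Lemma split_glue_N (P : Proset) (L : Translation P) (D : Category)
    (X : IntOb D L) : int_N (split_ob P L D (glue_rep P L D X)) = int_N X.
Proof.
apply (functor_ext (proset_cat P) D
  (int_N (split_ob P L D (glue_rep P L D X))) (int_N X) (fun i => eq_refl)).
intros i j h; simpl; now rewrite comp_idl, comp_idr.
Qed.

Lemma split_glue_ob (P : Proset) (L : Translation P) (D : Category)
    (X : IntOb D L) : split_ob P L D (glue_rep P L D X) = X.
Proof.
apply (IntOb_ext P L D _ _ (split_glue_M P L D X) (split_glue_N P L D X)
         (fun i => eq_refl) (fun i => eq_refl));
(* The glued map on [i <= (L i)'] is [phi i] followed by an identity of [N]. *)
intros i; simpl; rewrite comp_idl, comp_idr, rep_id; apply comp_idl.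
Qed.

Lemma eq_hom_int_gM (P : Proset) (L : Translation P) (D : Category)
    (X Y : Int D L) (e : X = Y) (i : proset_cat P)
    (ei : int_M X i = int_M Y i) :
  component (int_gM (eq_hom (Int D L) X Y e)) i = eq_hom D _ _ ei.
Proof. destruct e; simpl; now rewrite eq_hom_id. Qed.

Lemma eq_hom_int_gN (P : Proset) (L : Translation P) (D : Category)
    (X Y : Int D L) (e : X = Y) (i : proset_cat P)
    (ei : int_N X i = int_N Y i) :
  component (int_gN (eq_hom (Int D L) X Y e)) i = eq_hom D _ _ ei.
Proof. destruct e; simpl; now rewrite eq_hom_id. Qed.

Lemma split_glue (P : Proset) (L : Translation P) (D : Category) :
  comp_functor (split_functor P L D) (glue_functor P L D) = id_functor (Int D L).
Proof.
apply (functor_ext _ _ (comp_functor (split_functor P L D) (glue_functor P L D))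
  (id_functor (Int D L)) (split_glue_ob P L D)).
intros X Y a; apply IntHom_ext; apply NatTrans_ext; intros i; simpl.
- pose proof (eq_hom_int_gM P L D _ _ (split_glue_ob P L D X) i eq_refl) as EX.
  pose proof (eq_hom_int_gM P L D _ _ (split_glue_ob P L D Y) i eq_refl) as EY.
  simpl in *; now rewrite EX, EY, comp_idl, comp_idr.
- pose proof (eq_hom_int_gN P L D _ _ (split_glue_ob P L D X) i eq_refl) as EX.
  pose proof (eq_hom_int_gN P L D _ _ (split_glue_ob P L D Y) i eq_refl) as EY.
  simpl in *; now rewrite EX, EY, comp_idl, comp_idr.
Qed.

Theorem theorem3p6 (P : Proset) (L : Translation P) (D : Category) :
  cat_isomorphic (Rep (shoelace L) D) (Int D L).
Proof.
exists (split_functor P L D), (glue_functor P L D); split.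
- apply glue_split.
- apply split_glue.
Qed.
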